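(* Let $f_t\in\mathcal{S}^{2,1}_{\mu_t,L_t}(\mathbb{R}^n\times\mathbb{R}^n)$ for all $t\ge 1$, with $0<\mu_{\min}\le\mu_t\le L_t\le L_{\max}<\infty$ for all $t\ge1$. Suppose that there exist a constant $M_g$ and a set of initialization points $\{\mathbf{w}_T\}\subset\mathbb{R}^n$ such that $$\|\nabla f_T(\hat{\mathbf{x}}_{T-1|T-1},\mathbf{w}_T)\|\le M_g\qquad\text{for all } T\ge 2.$$ Then for every $t\ge0$ there exists $\mathbf{x}_t^*\in\mathbb{R}^n$ such that $\hat{\mathbf{x}}_{t|T}\to\mathbf{x}_t^*$ as $T\to\infty$ ($T\ge t$), and there is a constant $C_1$ depending on $\mu_{\min},L_{\max},M_g$ such that, for all $T\ge 1$ and $0\le t\le T$, $$\|\hat{\mathbf{x}}_{t|T}-\mathbf{x}_t^*\|\le C_1\left(\frac{2L_{\max}-\mu_{\min}}{2L_{\max}+\mu_{\min}}\right)^{T-t}.$$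
   Context: $\mathcal{S}^{2,1}_{\mu,L}(\mathcal{D})$ is the class of $\mu$-strongly convex functions on $\mathcal{D}$ with two continuous derivatives whose first derivative (gradient) is $L$-Lipschitz continuous on $\mathcal{D}$. For $T\ge1$, $J_T(\mathbf{x}_0,\dots,\mathbf{x}_T)=\sum_{t=1}^T f_t(\mathbf{x}_{t-1},\mathbf{x}_t)$ with each $\mathbf{x}_t\in\mathbb{R}^n$, and $(\hat{\mathbf{x}}_{0|T},\dots,\hat{\mathbf{x}}_{T|T})$ denotes the (unique) minimizer of $J_T$, so $\hat{\mathbf{x}}_{t|T}\in\mathbb{R}^n$ is its $t$-th block. $\|\cdot\|$ is the Euclidean norm. *)

(* Defs.v *)
From HB Require Import structures.
From mathcomp Require Import all_boot all_order all_algebra.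
From mathcomp Require Import all_classical all_reals all_analysis.

Set Implicit Arguments.
Unset Strict Implicit.
Unset Printing Implicit Defensive.

Import Order.TTheory GRing.Theory Num.Theory.
Import numFieldNormedType.Exports.

Local Open Scope classical_set_scope.
Local Open Scope ring_scope.

(* The norm [`|x|] that the library puts on row vectors is the sup norm; it
   induces the same topology as the Euclidean norm below, but quantitative
   statements must use [enorm]. *)
Definition enorm (R : realType) (m : nat) (x : 'rV[R]_m) : R :=
  Num.sqrt (\sum_(i < m) x 0 i ^+ 2).

Definition gradient (R : realType) (m : nat) (f : 'rV[R]_m -> R)
    (x : 'rV[R]_m) : 'rV[R]_m :=
  \row_(i < m) 'D_('e_i) f x.

(* Twice Frechet differentiable, with continuous Hessian matrix. *)
Definition twice_continuously_differentiable (R : realType) (m : nat)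
    (f : 'rV[R]_m -> R) : Prop :=
  [/\ forall x, differentiable f x,
      forall x, differentiable (gradient f) x &
      continuous (fun x => 'J (gradient f) x : 'M[R]_m)].

Definition strongly_convex (R : realType) (m : nat) (mu : R)
    (f : 'rV[R]_m -> R) : Prop :=
  forall (x y : 'rV[R]_m) (a : R), 0 <= a <= 1 ->
    f (a *: x + (1 - a) *: y) <=
      a * f x + (1 - a) * f y - mu / 2 * a * (1 - a) * enorm (x - y) ^+ 2.

(* The class S^{2,1}_{mu,L}(D) for D the whole space R^m. *)
Definition S21 (R : realType) (m : nat) (mu L : R) (f : 'rV[R]_m -> R) : Prop :=
  [/\ strongly_convex mu f,
      twice_continuously_differentiable f &
      forall x y : 'rV[R]_m,
        enorm (gradient f x - gradient f y) <= L * enorm (x - y)].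

(* R^n x R^n is identified with R^(n+n) through [row_mx].  A point
   (x_0, ..., x_T) of (R^n)^(T+1) is given by a sequence x : nat -> R^n of
   which only the entries of index at most T are read. *)
Definition J (R : realType) (n : nat) (f : nat -> 'rV[R]_(n + n) -> R)
    (T : nat) (x : nat -> 'rV[R]_n) : R :=
  \sum_(1 <= t < T.+1) f t (row_mx (x t.-1) (x t)).

Definition minimizer_of_J (R : realType) (n : nat)
    (f : nat -> 'rV[R]_(n + n) -> R) (T : nat) (x : nat -> 'rV[R]_n) : Prop :=
  forall y : nat -> 'rV[R]_n, J f T x <= J f T y.

(* Main.v *)
Require Import Defs.
From HB Require Import structures.
From mathcomp Require Import all_boot all_order all_algebra.
From mathcomp Require Import all_classical all_reals all_analysis.
From mathcomp Require Import ring lra.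

Import Order.TTheory GRing.Theory Num.Theory.
Import numFieldNormedType.Exports.

Local Open Scope classical_set_scope.
Local Open Scope ring_scope.

(* The gradient of J_(T+1) at (xhat_0|T, ..., xhat_T|T, w) vanishes except in
   its last two blocks, where it is the gradient of f_(T+1), of norm at most
   M_g; as J_(T+1) is mu-strongly convex, this point is within M_g / mu of the
   minimizer of J_(T+1).  Run gradient descent from it: a step with the optimal
   step size contracts the distance to the minimizer by
   rho = (2 L - mu) / (2 L + mu), because grad J is 2 L-Lipschitz, and since J
   couples only neighbouring blocks each step moves the set of modified blocks
   down by one.  Block t is thus untouched by T - t steps, whence
   |xhat_t|T+1 - xhat_t|T| <= (M_g / mu) rho^(T - t); sum over T. *)

(** * Positive semidefinite symmetric bilinear forms *)

(** Only semidefinite: the main instance, [sdot T] on infinite sequences, does not see the blocks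
    beyond [T], so it may vanish on nonzero sequences. *)
Definition psd_form {R : realType} {V : lmodType R} (B : V -> V -> R) : Prop :=
  [/\ forall u v, B u v = B v u,
      forall a u v w, B (a *: u + v) w = a * B u w + B v w &
      forall u, 0 <= B u u].

Section PsdForm.
Context {R : realType} {V : lmodType R} {B : V -> V -> R}.
Hypothesis psdB : psd_form B.

Lemma psd_formC u v : B u v = B v u.
Proof. by have [+ _ _] := psdB; apply. Qed.

Lemma psd_form_ge0 u : 0 <= B u u.
Proof. by have [_ _] := psdB; apply. Qed.

Lemma psd_formDl u v w : B (u + v) w = B u w + B v w.
Proof. by have [_ lin _] := psdB; rewrite -{1}[u]scale1r lin mul1r. Qed.

Lemma psd_form0l w : B 0 w = 0.
Proof. by have := psd_formDl 0 0 w; rewrite addr0; lra. Qed.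

Lemma psd_formZl a u w : B (a *: u) w = a * B u w.
Proof.
by have [_ lin _] := psdB; rewrite -[a *: u]addr0 lin psd_form0l addr0.
Qed.

Lemma psd_formNl u w : B (- u) w = - B u w.
Proof. by rewrite -scaleN1r psd_formZl mulN1r. Qed.

Lemma psd_formDr u v w : B w (u + v) = B w u + B w v.
Proof. by rewrite psd_formC psd_formDl !(psd_formC _ w). Qed.

Lemma psd_formZr a u w : B w (a *: u) = a * B w u.
Proof. by rewrite psd_formC psd_formZl (psd_formC _ w). Qed.

Lemma psd_formNr u w : B w (- u) = - B w u.
Proof. by rewrite psd_formC psd_formNl (psd_formC _ w). Qed.

Definition psd_formE := (psd_formDl, psd_formDr, psd_formZl, psd_formZr,
  psd_formNl, psd_formNr).

Lemma psd_form_Cauchy_Schwarz u v : B u v ^+ 2 <= B u u * B v v.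
Proof.
have quad s t : 0 <= s ^+ 2 * B u u + 2 * s * t * B u v + t ^+ 2 * B v v.
  have := psd_form_ge0 (s *: u + t *: v).
  by rewrite !psd_formE (psd_formC v u); lra.
have a0 := psd_form_ge0 u; have c0 := psd_form_ge0 v.
move: (B u u) (B u v) (B v v) a0 c0 quad => a b c a0 c0 quad.
have [c_gt0|c_le0] := ltP 0 c.
  rewrite -subr_ge0 -(pmulr_rge0 _ c_gt0).
  by have := quad c (- b); lra.
have c_eq0 : c = 0 by lra.
(* With [c = 0] the quadratic is affine in its second argument; this choice makes it
   [- (a + 2) * b ^+ 2], which forces [b ^+ 2 <= 0]. *)
have := quad (- b) (a + 1); rewrite c_eq0.
have : 0 <= b ^+ 2 * a by rewrite mulr_ge0 // sqr_ge0.
have : 0 <= b ^+ 2 by rewrite sqr_ge0.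
lra.
Qed.

Lemma sqrt_psd_formD u v :
  Num.sqrt (B (u + v) (u + v)) <= Num.sqrt (B u u) + Num.sqrt (B v v).
Proof.
have s0 : 0 <= Num.sqrt (B u u) + Num.sqrt (B v v) by rewrite addr_ge0.
rewrite -[leRHS]ger0_norm // -sqrtr_sqr ler_wsqrtr //.
rewrite sqrrD !sqr_sqrtr ?psd_form_ge0 // !psd_formE (psd_formC v u).
suff : B u v <= Num.sqrt (B u u) * Num.sqrt (B v v) by lra.
apply: le_trans (ler_norm _) _.
rewrite -sqrtrM ?psd_form_ge0 // -sqrtr_sqr ler_wsqrtr //.
exact: psd_form_Cauchy_Schwarz.
Qed.

(** * Gradient descent between two quadratic models *)

Section GradientDescent.
Context {F : V -> R} {G : V -> V} {mu M : R}.
Hypothesis muM : 0 < mu < M.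
Hypothesis quad_lower : forall x y,
  F x + B (G x) (y - x) + mu / 2 * B (y - x) (y - x) <= F y.
Hypothesis quad_upper : forall x y,
  F y <= F x + B (G x) (y - x) + M / 2 * B (y - x) (y - x).

(* Evaluate F at y - s / (M - mu), the minimizer over z of the upper model at y
   minus the lower model at x. *)
Lemma bregman_lower x y (s := G y - G x - mu *: (y - x)) :
  mu / 2 * B (y - x) (y - x) + (2 * (M - mu))^-1 * B s s
    <= F y - F x - B (G x) (y - x).
Proof.
have K0 : 0 < M - mu by case/andP: muM; lra.
pose t := (M - mu)^-1.
have tK : t * (M - mu) = 1 by rewrite mulVf // lt0r_neq0.
have -> : (2 * (M - mu))^-1 = t / 2 by rewrite invfM mulrC.
have := quad_lower x (y - t *: s); have := quad_upper y (y - t *: s).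
have -> : y - t *: s - y = - (t *: s) by rewrite addrAC subrr add0r.
have -> : y - t *: s - x = (y - x) - t *: s by rewrite addrAC.
have Gy : G y = G x + s + mu *: (y - x) by rewrite /s -addrA subrK addrC subrK.
rewrite {}Gy; move: s (y - x) => s e.
rewrite !psd_formE (psd_formC s e).
have : t * (t * (M - mu)) * B s s = t * B s s by rewrite tK mulr1.
lra.
Qed.

(** Add [bregman_lower] for [(x, y)] and for [(y, x)]: the values of [F] cancel, and [s] only
    changes sign. *)
Lemma gradient_cocoercive x y (s := G y - G x - mu *: (y - x)) :
  mu * B (y - x) (y - x) + (M - mu)^-1 * B s s <= B (G y - G x) (y - x).
Proof.
have := bregman_lower x y; have := bregman_lower y x.
have -> : G x - G y - mu *: (x - y) = - s.
  by rewrite -(opprB y x) -(opprB (G y)) scalerN -opprD.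
rewrite -(opprB y x) -/s invfM.
move: s (y - x) => s e; rewrite /= !psd_formE.
lra.
Qed.

Lemma gradient_step_contraction x y (h := 2 / (M + mu)) :
  B ((x - h *: G x) - (y - h *: G y)) ((x - h *: G x) - (y - h *: G y)) <=
  ((M - mu) / (M + mu)) ^+ 2 * B (x - y) (x - y).
Proof.
have [mu0 K0 N0] : [/\ 0 < mu, 0 < M - mu & 0 < M + mu].
  by case/andP: muM => *; split; lra.
have /= := gradient_cocoercive y x.
set s := G x - G y - _.
have -> : x - h *: G x - (y - h *: G y) = (x - y) - h *: (G x - G y).
  by rewrite opprD addrACA -opprD -scalerBr.
have -> : G x - G y = s + mu *: (x - y) by rewrite subrK.
move: s (x - y) => s e.
rewrite !psd_formE (psd_formC s e) => coc.
rewrite -subr_ge0.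
set d := (X in 0 <= X).
(* For this [h] the coefficient of [B e e] in [d] vanishes, and what remains is a nonnegative
   multiple of the slack in cocoercivity. *)
have -> : d = 2 * h * ((M - mu) / (M + mu)) * (B e s - (M - mu)^-1 * B s s).
  by rewrite /d /h; field; rewrite !lt0r_neq0.
have h0 : 0 <= h by rewrite divr_ge0 ?ltW.
have r0 : 0 <= (M - mu) / (M + mu) by rewrite divr_ge0 ?ltW.
apply: mulr_ge0; last by lra.
by apply: mulr_ge0 => //; lra.
Qed.

(** With [g = G y - G x] and [e = y - x], cocoercivity gives [mu * B e e <= B g e]; insert this into
    the expansion of [0 <= B (g - mu *: e) (g - mu *: e)]. It turns a small gradient into closeness
    to the minimizer. *)
Lemma gradient_error_bound x y :
  mu ^+ 2 * B (y - x) (y - x) <= B (G y - G x) (G y - G x).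
Proof.
have [mu0 K0] : 0 < mu /\ 0 < M - mu by case/andP: muM => *; split; lra.
have /= := gradient_cocoercive x y.
set s := G y - G x - _; move=> coc.
have s0 : 0 <= (M - mu)^-1 * B s s.
  by rewrite mulr_ge0 ?psd_form_ge0 // invr_ge0 ltW.
have : 0 <= mu * (B (G y - G x) (y - x) - mu * B (y - x) (y - x)).
  by rewrite mulr_ge0 ?(ltW mu0) //; lra.
have := psd_form_ge0 s; rewrite /s.
move: (G y - G x) (y - x) => g e; rewrite !psd_formE (psd_formC e g).
lra.
Qed.

Lemma gradient_descent_rate x xs k (h := 2 / (M + mu))
    (xk := iter k (fun z => z - h *: G z) x) :
  G xs = 0 ->
  B (xk - xs) (xk - xs) <=
    ((M - mu) / (M + mu)) ^+ (2 * k) * B (x - xs) (x - xs).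
Proof.
move=> Gxs; rewrite {}/xk; elim: k => [|k IHk]; first by rewrite muln0 mul1r.
rewrite iterS; set xk := iter k _ x in IHk *.
have /= := gradient_step_contraction xk xs.
rewrite Gxs scaler0 subr0 => /le_trans; apply.
by rewrite mulnS exprD -mulrA ler_wpM2l // sqr_ge0.
Qed.

(** Otherwise a step of length [M^-1] along [- G x] would lower [F], by at least
    [B (G x) (G x) / (2 * M)]. As [B] may be degenerate, [G x = 0] cannot be concluded here. *)
Lemma minimizer_gradient_le0 x :
  (forall y, F x <= F y) -> B (G x) (G x) <= 0.
Proof.
have M0 : 0 < M by case/andP: muM; exact: lt_trans.
move=> /(_ (x - M^-1 *: G x)); have := quad_upper x (x - M^-1 *: G x).
have -> : x - M^-1 *: G x - x = - (M^-1 *: G x) by rewrite addrAC subrr add0r.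
rewrite !psd_formE => h1 h2.
rewrite -(pmulr_rle0 _ (_ : 0 < M^-1)) ?invr_gt0 //.
have : M / 2 * - - (M^-1 * (M^-1 * B (G x) (G x))) = M^-1 * B (G x) (G x) / 2.
  by field; rewrite lt0r_neq0.
lra.
Qed.
End GradientDescent.

End PsdForm.

(** * The Euclidean inner product and norm *)

Definition dot {R : realType} {m : nat} (u v : 'rV[R]_m) : R :=
  \sum_(i < m) u 0 i * v 0 i.

Lemma dot_psd_form (R : realType) (m : nat) : psd_form (@dot R m).
Proof.
split=> [u v|a u v w|u].
- by apply: eq_bigr => i _; rewrite mulrC.
- rewrite /dot mulr_sumr -big_split /=; apply: eq_bigr => i _.
  by rewrite !mxE mulrDl mulrA.
- by apply: sumr_ge0 => i _; rewrite -expr2 sqr_ge0.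
Qed.

Lemma dot_row_mx {R : realType} {n : nat} (a b c d : 'rV[R]_n) :
  dot (row_mx a b) (row_mx c d) = dot a c + dot b d.
Proof.
rewrite /dot big_split_ord /=; congr (_ + _); apply: eq_bigr => i _.
  by rewrite !row_mxEl.
by rewrite !row_mxEr.
Qed.

Lemma enormE {R : realType} {m : nat} (u : 'rV[R]_m) :
  enorm u = Num.sqrt (dot u u).
Proof. by congr Num.sqrt; apply: eq_bigr => i _; rewrite expr2. Qed.

Lemma enorm_sqr {R : realType} {m : nat} (u : 'rV[R]_m) :
  enorm u ^+ 2 = dot u u.
Proof. by rewrite enormE sqr_sqrtr // psd_form_ge0 //; exact: dot_psd_form. Qed.

Lemma enorm_ge0 {R : realType} {m : nat} (u : 'rV[R]_m) : 0 <= enorm u.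
Proof. exact: sqrtr_ge0. Qed.

Lemma enormD {R : realType} {m : nat} (u v : 'rV[R]_m) :
  enorm (u + v) <= enorm u + enorm v.
Proof. by rewrite !enormE; apply: sqrt_psd_formD; exact: dot_psd_form. Qed.

Lemma dot_le_enorm {R : realType} {m : nat} (u v : 'rV[R]_m) :
  dot u v <= enorm u * enorm v.
Proof.
apply: le_trans (ler_norm _) _.
rewrite !enormE -sqrtrM ?psd_form_ge0 //; last exact: dot_psd_form.
rewrite -sqrtr_sqr ler_wsqrtr //.
by apply: psd_form_Cauchy_Schwarz; exact: dot_psd_form.
Qed.

Lemma enormZ {R : realType} {m : nat} (a : R) (u : 'rV[R]_m) :
  enorm (a *: u) = `|a| * enorm u.
Proof.
have dB := dot_psd_form R m.
rewrite !enormE (psd_formZl dB) (psd_formZr dB) mulrA -expr2.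
by rewrite sqrtrM ?sqr_ge0 // sqrtr_sqr.
Qed.

(** * Quadratic models from strong convexity and a Lipschitz gradient *)

Section QuadraticBounds.
Context {R : realType} {m : nat} {f : 'rV[R]_m -> R}.

Lemma derive_gradient x v :
  differentiable f x -> 'D_v f x = dot (gradient f x) v.
Proof.
move=> df; rewrite deriveE // {1}[v]row_sum_delta linear_sum /=.
apply: eq_bigr => i _.
by rewrite linearZ /= mxE deriveE // mulrC.
Qed.

Lemma is_derive_line (x v : 'rV[R]_m) (a : R) :
  differentiable f (x + a *: v) ->
  is_derive a 1 (fun b : R => f (x + b *: v)) (dot (gradient f (x + a *: v)) v).
Proof.
move=> df; rewrite -derive_gradient //.
have E : (fun h : R => h^-1 *:
    (((fun b : R => f (x + b *: v)) \o shift a) (h *: 1) - f (x + a *: v))) =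
    (fun h : R => h^-1 *:
      ((f \o shift (x + a *: v)) (h *: v) - f (x + a *: v))).
  apply/funext => h /=; congr (_ *: (f _ - _)).
  by rewrite scalerDl [h *: 1]mulr1 addrCA.
split; last by rewrite /derive E.
by rewrite /derivable E; exact: diff_derivable.
Qed.

(** Along the segment, [f] minus its upper model has derivative at most 0 by Cauchy-Schwarz and the
    Lipschitz bound, so the mean value theorem suffices and no integral is taken. *)
Lemma lipschitz_gradient_upper (L : R) (x y : 'rV[R]_m) :
  (forall z, differentiable f z) ->
  (forall u v, enorm (gradient f u - gradient f v) <= L * enorm (u - v)) ->
  f y <= f x + dot (gradient f x) (y - x) + L / 2 * dot (y - x) (y - x).
Proof.
move=> df lip; set v := y - x.
have dB := dot_psd_form R m.
pose psi (a : R) := f (x + a *: v) -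
  (dot (gradient f x) v * a + L / 2 * dot v v * a ^+ 2).
pose dpsi (a : R) := dot (gradient f (x + a *: v)) v -
  (dot (gradient f x) v + L * dot v v * a).
have psi_derive (a : R) : is_derive a 1 psi (dpsi a).
  have h1 := is_derive_line _ _ _ (df (x + a *: v)).
  rewrite /psi /dpsi; apply: is_derive_eq.
  by rewrite /GRing.scale /=; field.
have [|c] := @MVT R psi dpsi 0 1 ltr01 (fun a _ => psi_derive a).
  apply: continuous_subspaceT => a.
  apply: differentiable_continuous; apply/derivable1_diffP.
  by have [] := psi_derive a.
rewrite in_itv /= => /andP[c0 c1].
rewrite /psi scale1r scale0r addr0 expr0n /= !mulr0 [x + v]addrC subrK => E.
suff : dpsi c <= 0 by lra.
have : dot (gradient f (x + c *: v) - gradient f x) v <= L * c * dot v v.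
  apply: le_trans (dot_le_enorm _ _) _.
  rewrite -enorm_sqr expr2 mulrA ler_wpM2r ?enorm_ge0 //.
  apply: le_trans (lip _ _) _.
  by rewrite addrAC subrr add0r enormZ gtr0_norm // mulrA.
rewrite (psd_formDl dB) (psd_formNl dB) /dpsi.
lra.
Qed.

(** Apply strong convexity at [x + h *: v], divide by [h] and let [h] tend to 0 from the right. *)
Lemma strongly_convex_lower (mu : R) (x y : 'rV[R]_m) :
  differentiable f x -> strongly_convex mu f ->
  f x + dot (gradient f x) (y - x) + mu / 2 * dot (y - x) (y - x) <= f y.
Proof.
move=> df sc; set v := y - x.
rewrite -derive_gradient //.
suff : 'D_v f x <= f y - f x - mu / 2 * dot v v by lra.
have /cvg_dnbhs_at_right lim_f :
    (fun h : R => h^-1 *: ((f \o shift x) (h *: v) - f x)) @ 0^' --> 'D_v f x.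
  exact: diff_derivable.
(* This is the part of the [h * (1 - h)] term that survives division by [h] and depends on [h];
   subtracting it on the left leaves a constant bound on the right. *)
have lim_r : (fun h : R => mu / 2 * dot v v * h) @ 0^'+ --> (0 : R).
  rewrite -[X in _ --> X](mulr0 (mu / 2 * dot v v)).
  by apply: cvgM; [exact: cvg_cst|exact: cvg_at_right_filter].
have := cvgB lim_f lim_r; rewrite subr0 => lim_fr; apply: (cvgr_to_le (lim_fr _)).
near=> h.
have h0 : 0 < h by near: h; exact: nbhs_right_gt.
have h1 : h <= 1 by near: h; exact: nbhs_right_le.
have := sc y x h; rewrite (ltW h0) h1 enorm_sqr => /(_ isT).
have -> : h *: y + (1 - h) *: x = h *: v + x.
  by rewrite scalerBl scale1r scalerBr [x - _]addrC addrA.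
rewrite -/v => sc_h.
rewrite -[leLHS](mulKf (lt0r_neq0 h0)) -[leRHS](mulKf (lt0r_neq0 h0)).
rewrite ler_wpM2l ?invr_ge0 ?(ltW h0) //= mulrBr.
rewrite /GRing.scale /= mulVKf ?lt0r_neq0 //.
lra.
Unshelve. all: by end_near.
Qed.

End QuadraticBounds.

(** * Sequences of blocks and their overlapping stages *)

Definition sdot {R : realType} {n : nat} (T : nat) (x y : nat -> 'rV[R]_n) : R :=
  \sum_(t < T.+1) dot (x t) (y t).

Lemma sdot_psd_form (R : realType) (n T : nat) : psd_form (@sdot R n T).
Proof.
have [dC dL d0] := dot_psd_form R n.
split=> [x y|a x y z|x].
- by apply: eq_bigr => t _; exact: dC.
- by rewrite /sdot mulr_sumr -big_split; apply: eq_bigr => t _; exact: dL.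
- by apply: sumr_ge0 => t _; exact: d0.
Qed.

Lemma dot_le_sdot {R : realType} {n : nat} (T t : nat) (x : nat -> 'rV[R]_n) :
  (t <= T)%N -> dot (x t) (x t) <= sdot T x x.
Proof.
have [_ _ d0] := dot_psd_form R n.
rewrite -ltnS => tT; rewrite /sdot (bigD1 (Ordinal tT)) //= lerDl.
by apply: sumr_ge0 => i _; exact: d0.
Qed.

Lemma dot_eq0 {R : realType} {m : nat} (u : 'rV[R]_m) : dot u u <= 0 -> u = 0.
Proof.
move=> u0; apply/rowP => i; rewrite mxE; apply/eqP.
rewrite -sqrf_eq0 eq_le sqr_ge0 andbT; apply: le_trans u0.
rewrite /dot (bigD1 i) //= -expr2 lerDl.
by apply: sumr_ge0 => j _; rewrite -expr2 sqr_ge0.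
Qed.

Definition stage {R : realType} {n : nat} (x : nat -> 'rV[R]_n) (t : nat) :
    'rV[R]_(n + n) := row_mx (x t) (x t.+1).

(* The transpose of x |-> (stage x t)_(t < T). *)
Definition stage_adjoint {R : realType} {n : nat} (T : nat)
    (s : nat -> 'rV[R]_(n + n)) (t : nat) : 'rV[R]_n :=
  (if (t < T)%N then lsubmx (s t) else 0) +
  (if (0 < t <= T)%N then rsubmx (s t.-1) else 0).

(** Left halves pair with [x t] and miss the block [T]; right halves pair with [x t.+1] and miss the
    block 0. This is the chain rule behind [grad_J]. *)
Lemma sdot_stage_adjoint {R : realType} {n : nat} (T : nat)
    (s : nat -> 'rV[R]_(n + n)) (x : nat -> 'rV[R]_n) :
  sdot T (stage_adjoint T s) x = \sum_(t < T) dot (s t) (stage x t).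
Proof.
have dB := dot_psd_form R n.
have d0 := psd_form0l dB.
under [RHS]eq_bigr => t _ do rewrite -[s t]hsubmxK dot_row_mx.
rewrite /sdot /stage_adjoint; under [LHS]eq_bigr do rewrite (psd_formDl dB).
rewrite !big_split /=; congr (_ + _).
  rewrite big_ord_recr /= ltnn d0 addr0.
  by apply: eq_bigr => t _; rewrite ltn_ord.
by rewrite big_ord_recl d0 add0r; apply: eq_bigr => t _; rewrite /= ltn_ord.
Qed.

(** Once there is a stage, every block up to [T] lies in at least one, so [J] inherits the convexity
    modulus of the stages. *)
Lemma sdot_le_stage {R : realType} {n : nat} (T : nat) (x : nat -> 'rV[R]_n) :
  (0 < T)%N -> sdot T x x <= \sum_(t < T) dot (stage x t) (stage x t).
Proof.
have [_ _ d0] := dot_psd_form R n.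
case: T => // T _; under [leRHS]eq_bigr do rewrite dot_row_mx.
rewrite big_split /= /sdot big_ord_recr /= lerD2l big_ord_recr /= lerDr.
by apply: sumr_ge0 => t _; exact: d0.
Qed.

(** Every block lies in at most two stages: the source of the 2 in [2 * L]. *)
Lemma stage_le_sdot {R : realType} {n : nat} (T : nat) (x : nat -> 'rV[R]_n) :
  \sum_(t < T) dot (stage x t) (stage x t) <= 2 * sdot T x x.
Proof.
have [_ _ d0] := dot_psd_form R n.
under eq_bigr do rewrite dot_row_mx.
rewrite big_split /= mulrDl mul1r lerD //; rewrite /sdot.
  by rewrite big_ord_recr /= lerDl; exact: d0.
by rewrite big_ord_recl /= lerDr; exact: d0.
Qed.

(** * The objective [J], its gradient and its quadratic models *)

Lemma JE {R : realType} {n : nat} (f : nat -> 'rV[R]_(n + n) -> R) T x :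
  J f T x = \sum_(t < T) f t.+1 (stage x t).
Proof. by rewrite /J big_add1 big_mkord. Qed.

(** The gradient of [J f T] with respect to [sdot T]: block [t] collects the right half of the
    gradient of [f t] and the left half of that of [f t.+1]. *)
Definition grad_J {R : realType} {n : nat} (f : nat -> 'rV[R]_(n + n) -> R)
    (T : nat) (x : nat -> 'rV[R]_n) : nat -> 'rV[R]_n :=
  stage_adjoint T (fun t => gradient (f t.+1) (stage x t)).

Lemma stageB {R : realType} {n : nat} (x y : nat -> 'rV[R]_n) t :
  stage (x - y) t = stage x t - stage y t.
Proof. by rewrite /stage opp_row_mx add_row_mx. Qed.

(** In this form the hypotheses on the [f t] can be summed over the stages. *)
Definition quad_bounds {R : realType} {m : nat} (mu L : R) (f : 'rV[R]_m -> R) :=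
  forall x y,
    f x + dot (gradient f x) (y - x) + mu / 2 * dot (y - x) (y - x) <= f y /\
    f y <= f x + dot (gradient f x) (y - x) + L / 2 * dot (y - x) (y - x).

Lemma S21_quad_bounds {R : realType} {m : nat} {mu L : R} {f : 'rV[R]_m -> R}
    (mu' L' : R) :
  mu' <= mu -> L <= L' -> S21 mu L f -> quad_bounds mu' L' f.
Proof.
move=> mu'mu LL' [sc [df _ _] lip] x y.
have e0 : 0 <= dot (y - x) (y - x) by apply: psd_form_ge0; exact: dot_psd_form.
split.
  apply: le_trans (strongly_convex_lower _ x y (df x) sc).
  by rewrite lerD2l ler_wpM2r // ler_pM2r // invr_gt0.
apply: le_trans (lipschitz_gradient_upper _ x y df lip) _.
by rewrite lerD2l ler_wpM2r // ler_pM2r // invr_gt0.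
Qed.

Section JBounds.
Context {R : realType} {n : nat} {f : nat -> 'rV[R]_(n + n) -> R} {mu L : R}.
Hypothesis mu_gt0 : 0 < mu.
Hypothesis mu_le_L : mu <= L.
Hypothesis f_bounds : forall t, quad_bounds mu L (f t.+1).

Lemma J_quad_lower T x y : (0 < T)%N ->
  J f T x + sdot T (grad_J f T x) (y - x) + mu / 2 * sdot T (y - x) (y - x)
    <= J f T y.
Proof.
move=> T0.
apply: (@le_trans _ _ (J f T x + sdot T (grad_J f T x) (y - x) +
    mu / 2 * \sum_(t < T) dot (stage (y - x) t) (stage (y - x) t))).
  by rewrite lerD2l ler_wpM2l ?sdot_le_stage // divr_ge0 // ltW.
rewrite sdot_stage_adjoint !JE mulr_sumr -!big_split /=.
apply: ler_sum => t _; rewrite stageB.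
by have [] := f_bounds t (stage x t) (stage y t).
Qed.

Lemma J_quad_upper T x y :
  J f T y <=
  J f T x + sdot T (grad_J f T x) (y - x) + (2 * L) / 2 * sdot T (y - x) (y - x).
Proof.
apply: (@le_trans _ _ (J f T x + sdot T (grad_J f T x) (y - x) +
    L / 2 * \sum_(t < T) dot (stage (y - x) t) (stage (y - x) t))).
  rewrite sdot_stage_adjoint !JE mulr_sumr -!big_split /=.
  apply: ler_sum => t _; rewrite stageB.
  by have [] := f_bounds t (stage x t) (stage y t).
have -> : 2 * L / 2 = L / 2 * 2 by ring.
rewrite lerD2l -[leRHS]mulrA ler_wpM2l ?stage_le_sdot // divr_ge0 //.
exact: le_trans (ltW mu_gt0) mu_le_L.
Qed.

Lemma grad_J_minimizer T x : minimizer_of_J f T x -> grad_J f T x = 0.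
Proof.
move=> x_min; have mu2L : 0 < mu < 2 * L.
  by rewrite mu_gt0 /=; move: mu_gt0 mu_le_L; lra.
have G0 := minimizer_gradient_le0 (sdot_psd_form R n T) mu2L (J_quad_upper T) _ x_min.
(* Blocks up to [T] vanish because [sdot] dominates each of them; later ones are 0 by the definition
   of [stage_adjoint]. *)
apply/funext => t; have [tT|Tt] := leqP t T.
  by apply: dot_eq0; apply: le_trans (dot_le_sdot _ _ _ tT) G0.
by rewrite /grad_J /stage_adjoint ltnNge (ltnW Tt) /= [(t <= T)%N]leqNgt Tt andbF addr0.
Qed.

End JBounds.

(** * From the horizon [T] to the horizon [T.+1] *)

Section Truncation.
Context {R : realType} {n : nat} {f : nat -> 'rV[R]_(n + n) -> R} {mu L : R}.
Hypothesis mu_gt0 : 0 < mu.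
Hypothesis mu_le_L : mu <= L.
Hypothesis f_bounds : forall t, quad_bounds mu L (f t.+1).
Variables (T : nat) (x : nat -> 'rV[R]_n) (w : 'rV[R]_n).
Hypothesis x_min : minimizer_of_J f T x.

Let y (t : nat) := if (t <= T)%N then x t else w.

(** For [t < T] the block [t] of the gradient has the same formula at both horizons, and it reads no
    entry beyond [t.+1]. *)
Lemma grad_J_stationary_extend z t :
  (t < T)%N -> (forall s, (s <= t.+1)%N -> z s = x s) -> grad_J f T.+1 z t = 0.
Proof.
move=> tT zx.
have := congr1 (@^~ t) (grad_J_minimizer mu_gt0 mu_le_L f_bounds _ _ x_min).
rewrite /grad_J /stage_adjoint !ltnS (ltnW tT) tT (leqW (ltnW tT)) andbT.
by rewrite /stage !zx ?ltnS ?leq_pred // (leq_trans (leq_pred _)).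
Qed.

Lemma descent_unchanged h k t :
  (t + k <= T)%N -> iter k (fun z => z - h *: grad_J f T.+1 z) y t = x t.
Proof.
elim: k t => [|k IHk] t; first by rewrite addn0 /= /y => ->.
rewrite addnS iterS => tkT; set z := iter k _ y in IHk *.
have zx s : (s <= t.+1)%N -> z s = x s.
  by move=> st; apply: IHk; apply: leq_trans tkT; rewrite -addSn leq_add2r.
have tT : (t < T)%N by apply: leq_trans tkT; rewrite ltnS leq_addr.
have -> : (z - h *: grad_J f T.+1 z) t = z t - h *: grad_J f T.+1 z t by [].
by rewrite (grad_J_stationary_extend _ _ tT zx) scaler0 subr0 zx.
Qed.

Lemma grad_J_extend_norm (g := gradient (f T.+1) (row_mx (x T) w)) :
  sdot T.+1 (grad_J f T.+1 y) (grad_J f T.+1 y) = dot g g.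
Proof.
have yT : stage y T = row_mx (x T) w by rewrite /stage /y leqnn ltnn.
rewrite /sdot !big_ord_recr /= big1 ?add0r => [|t _]; last first.
  rewrite grad_J_stationary_extend //; last first.
    by move=> s st; rewrite /y (leq_trans st).
  by apply: psd_form0l; exact: dot_psd_form.
have -> : grad_J f T.+1 y T.+1 = rsubmx g.
  by rewrite /grad_J /stage_adjoint ltnn leqnn add0r yT.
have -> : grad_J f T.+1 y T = lsubmx g.
  (* The contribution of [f T] to block [T] is the whole block [T] of [grad_J f T x], hence 0; for
     [T = 0] there is no such contribution. *)
  have := congr1 (@^~ T) (grad_J_minimizer mu_gt0 mu_le_L f_bounds _ _ x_min).
  rewrite /grad_J /stage_adjoint ltnn ltnSn leqnn leqnSn !andbT add0r yT.
  case: (ltnP 0 T) => [T0 stat|_ _]; last by rewrite addr0.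
  have -> : stage y T.-1 = stage x T.-1.
    by rewrite /stage /y prednK // leqnn leq_pred.
  by rewrite stat addr0.
by rewrite -dot_row_mx hsubmxK.
Qed.

Lemma minimizer_increment xb t (M_g : R) :
  (0 < T)%N -> minimizer_of_J f T.+1 xb ->
  enorm (gradient (f T.+1) (row_mx (x T) w)) <= M_g -> (t <= T)%N ->
  enorm (xb t - x t) <=
    M_g / mu * ((2 * L - mu) / (2 * L + mu)) ^+ (T - t).
Proof.
move=> T0 xb_min gM tT.
have mu2L : 0 < mu < 2 * L.
  by rewrite mu_gt0 /=; move: mu_gt0 mu_le_L; lra.
have sB := sdot_psd_form R n T.+1.
have lower := fun a b => J_quad_lower mu_gt0 f_bounds T.+1 a b isT.
have upper := J_quad_upper mu_gt0 mu_le_L f_bounds T.+1.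
have Gxb := grad_J_minimizer mu_gt0 mu_le_L f_bounds _ _ xb_min.
have := gradient_descent_rate sB mu2L lower upper y xb (T - t) Gxb.
have := gradient_error_bound sB mu2L lower upper xb y.
set rho := (_ - _) / _; set xk := iter _ _ _.
rewrite Gxb subr0 grad_J_extend_norm -enorm_sqr => err rate.
have rho0 : 0 <= rho by case/andP: mu2L => m0 m1; rewrite divr_ge0 //; lra.
have M0 : 0 <= M_g := le_trans (enorm_ge0 _) gM.
have mu0 := mu_gt0.
rewrite -(@ler_pXn2r _ 2) ?nnegrE ?enorm_ge0 //; last first.
  by rewrite mulr_ge0 ?exprn_ge0 // divr_ge0 // ltW.
rewrite enorm_sqr.
have -> : xb t - x t = - (xk - xb) t.
  (* [T - t] is the largest number of steps for which [descent_unchanged] keeps block [t], so [x t]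
     can be read off [xk]. *)
  by rewrite /= -(descent_unchanged (2 / (2 * L + mu)) (T - t) t) ?subnKC // opprB.
have dB := dot_psd_form R n.
rewrite (psd_formNl dB) (psd_formNr dB) opprK.
apply: le_trans (dot_le_sdot _ _ _ (leqW tT)) _.
apply: le_trans rate _.
rewrite [leRHS]exprMn [leRHS]mulrC -exprM mulnC ler_wpM2l ?exprn_ge0 //.
rewrite expr_div_n ler_pdivlMr ?exprn_gt0 // mulrC.
apply: le_trans err _.
by rewrite ler_pXn2r ?nnegrE ?enorm_ge0.
Qed.

End Truncation.

(** * Limits of sequences with geometric increments *)

Lemma norm_le_enorm {R : realType} {m : nat} (u : 'rV[R]_m) : `|u| <= enorm u.
Proof.
rewrite /Num.norm /= mx_normrE; apply: bigmax_le => [|[i j] _ /=].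
  exact: enorm_ge0.
rewrite -sqrtr_sqr ler_wsqrtr // ord1 (bigD1 j) //= lerDl.
by apply: sumr_ge0 => k _; rewrite sqr_ge0.
Qed.

Lemma enorm_continuous (R : realType) (m : nat) : continuous (@enorm R m).
Proof.
move=> u; apply: (@continuous_comp _ _ _ (fun x : 'rV[R]_m => \sum_(i < m) x 0 i ^+ 2)
  Num.sqrt); last exact: sqrt_continuous.
apply: (@cvg_big _ _ _ _ _ _ _ (nbhs u) _ (fun i (x : 'rV[R]_m) => x 0 i ^+ 2)) => [|i _].
  exact: add_continuous.
rewrite /= expr2; under eq_fun do rewrite expr2.
by apply: cvgM; exact: coord_continuous.
Qed.

Lemma geometric_increments_cvg {R : realType} {m : nat} (u : nat -> 'rV[R]_m)
    (c rho : R) :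
  0 <= rho < 1 ->
  (forall k, enorm (u k.+1 - u k) <= c * rho ^+ k) ->
  exists l : 'rV[R]_m, u @ \oo --> l /\ forall k, enorm (u k - l) <= c / (1 - rho) * rho ^+ k.
Proof.
move=> /andP[rho0 rho1] incr.
have r0 : 0 < 1 - rho by lra.
have c0 : 0 <= c by have := le_trans (enorm_ge0 _) (incr 0%N); rewrite mulr1.
have dist k j : enorm (u k - u (k + j)%N) <= c / (1 - rho) * rho ^+ k.
  (* The exact partial geometric sum is kept so that the induction on [j] closes; bounding it by the
     full series comes afterwards. *)
  suff : enorm (u k - u (k + j)%N) <=
      c / (1 - rho) * (rho ^+ k - rho ^+ (k + j)).
    move=> /le_trans; apply; rewrite ler_wpM2l ?divr_ge0 ?(ltW r0) //.
    by rewrite gerBl exprn_ge0.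
  elim: j => [|j IHj].
    rewrite addn0 !subrr mulr0 -[0 : 'rV_m](scale0r 0) enormZ normr0 mul0r //.
  have -> : u k - u (k + j.+1)%N =
      (u k - u (k + j)%N) + - 1 *: (u (k + j).+1 - u (k + j)%N).
    by rewrite addnS scaleN1r opprB addrA subrK.
  apply: le_trans (enormD _ _) _; rewrite enormZ normrN normr1 mul1r.
  apply: le_trans (lerD IHj (incr _)) _.
  rewrite addnS [rho ^+ (k + j).+1]exprS le_eqVlt; apply/orP; left; apply/eqP.
  by field; rewrite lt0r_neq0.
have small : (fun k => c / (1 - rho) * rho ^+ k) @ \oo --> (0 : R).
  by apply: cvg_geometric; rewrite ger0_norm.
have u_cvg : cvg (u @ \oo).
  apply/cauchy_cvgP; apply: cauchy_exP => e e0.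
  have [N _ Ne] : \forall k \near \oo, c / (1 - rho) * rho ^+ k < e.
    exact: (cvgr_lt _ small).
  exists (u N); exists N => // k /= Nk.
  rewrite -ball_normE /=; apply: le_lt_trans (norm_le_enorm _) _.
  by rewrite -(subnKC Nk); apply: le_lt_trans (dist _ _) (Ne _ (leqnn N)).
exists (lim (u @ \oo)); split=> // k.
(* Let [j] tend to infinity in [dist] with [k] fixed. *)
have lim_k : (fun j => enorm (u k - u j)) @ \oo --> enorm (u k - lim (u @ \oo)).
  apply: continuous_cvg; first exact: enorm_continuous.
  by apply: cvgB => //; exact: cvg_cst.
apply: (cvgr_to_le lim_k).
by exists k => // j /= kj; rewrite -(subnKC kj).
Qed.

Theorem theorem2 (R : realType) (mu_min L_max M_g : R) :
  exists C1 : R,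
    forall (n : nat) (f : nat -> 'rV[R]_(n + n) -> R) (mu L : nat -> R)
      (xhat : nat -> nat -> 'rV[R]_n) (w : nat -> 'rV[R]_n),
      0 < mu_min ->
      (forall t : nat, (1 <= t)%N -> mu_min <= mu t /\ mu t <= L t /\ L t <= L_max) ->
      (forall t : nat, (1 <= t)%N -> S21 (mu t) (L t) (f t)) ->
      (forall T : nat, (1 <= T)%N -> minimizer_of_J f T (xhat T)) ->
      (forall T : nat, (2 <= T)%N ->
         enorm (gradient (f T) (row_mx (xhat T.-1 T.-1) (w T))) <= M_g) ->
      exists xstar : nat -> 'rV[R]_n,
        (forall t : nat, (fun T : nat => xhat T t) @ \oo --> xstar t) /\
        (forall T t : nat, (1 <= T)%N -> (t <= T)%N ->
           enorm (xhat T t - xstar t) <=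
             C1 * ((2 * L_max - mu_min) / (2 * L_max + mu_min)) ^+ (T - t)).
Proof.
pose rho := (2 * L_max - mu_min) / (2 * L_max + mu_min).
(* [M_g / mu_min] comes from one increment of the horizon and [1 / (1 - rho)] from the geometric
   series. *)
exists (M_g / mu_min / (1 - rho)) => n f mu L xhat w mu0 muL fS xhat_min gM.
have mu_le_L : mu_min <= L_max.
  by have [m1 [m2 m3]] := muL 1%N isT; lra.
have f_bounds t : quad_bounds mu_min L_max (f t.+1).
  have [m1 [m2 m3]] := muL t.+1 isT.
  by apply: S21_quad_bounds m1 m3 (fS _ _).
have rho01 : 0 <= rho < 1.
  by rewrite /rho divr_ge0 ?ltr_pdivrMr /=; lra.
suff block t : exists l : 'rV[R]_n, (fun T => xhat T t) @ \oo --> l /\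
    forall T, (1 <= T)%N -> (t <= T)%N ->
      enorm (xhat T t - l) <= M_g / mu_min / (1 - rho) * rho ^+ (T - t).
  have [xstar xstarP] := choice block.
  exists xstar; split=> [t|T t T1 tT]; first by have [] := xstarP t.
  by have [_] := xstarP t; apply.
(* Start at [N]: block [t] exists only from the horizon [t] on, and the bound [M_g] for the passage
   from [T] to [T.+1] is available only for [T] at least 1. The offset [rho ^+ (N - t)] goes into
   the constant and restores the exponent [T - t] at the end. *)
pose N := maxn t 1.
have tN : (t <= N)%N by rewrite leq_maxl.
have N0 : (0 < N)%N by rewrite leq_maxr.
have [//|k|l [ul dl]] := @geometric_increments_cvg R n (fun k => xhat (k + N)%N t)
    (M_g / mu_min * rho ^+ (N - t)) rho.
  have kN0 : (0 < k + N)%N by rewrite addn_gt0 N0 orbT.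
  rewrite -mulrA -exprD [(N - t + k)%N]addnC addnBA //.
  have := minimizer_increment mu0 mu_le_L f_bounds (k + N) _ (w (k + N).+1)
    (xhat_min _ kN0) (xhat (k + N).+1) t M_g kN0.
  apply; [exact: xhat_min|exact: gM|exact: leq_trans (leq_addl _ _)].
exists l; split=> [|T T1 tT]; first by rewrite -(cvg_shiftn N).
have NT : (N <= T)%N by rewrite geq_max tT.
have := dl (T - N)%N; rewrite subnK // => /le_trans; apply.
rewrite [M_g / _ * rho ^+ _ / _]mulrAC -[leLHS]mulrA -exprD.
by rewrite [(N - t + _)%N]addnC addnBA // subnK.
Qed.
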